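(* Let $(\delta_i^2,\widehat{w}_i)_{i=1}^n$ be the generalized eigenvalue-eigenvector pairs of the pencil $(H,\Gamma_{\rm pr}^{-1})$, i.e. $H\widehat{w}_i=\delta_i^2\,\Gamma_{\rm pr}^{-1}\widehat{w}_i$, with the ordering $\delta_i^2\ge\delta_{i+1}^2$ and the normalization $\widehat{w}_i^\top\Gamma_{\rm pr}^{-1}\widehat{w}_j=\delta_{ij}$ (Kronecker delta). Let $1\le r\le n$ and let $$\widehat{\Gamma}_{\rm pos}=\Gamma_{\rm pr}-\sum_{i=1}^r\delta_i^2(1+\delta_i^2)^{-1}\,\widehat{w}_i\widehat{w}_i^\top .$$ Then: (i) A solution of the problem of minimizing $\mathbb{E}\big(\|Ay-x\|^2_{\Gamma_{\rm pos}^{-1}}\big)$ over $A\in\widehat{\mathcal{A}}_r$ is given by $$\widehat{A}^\ast=\widehat{\Gamma}_{\rm pos}\,G^\top\Gamma_{\rm obs}^{-1}.$$ (ii) The corresponding minimum Bayes risk over $\widehat{\mathcal{A}}_r$ is $$\mathbb{E}\big(\|\widehat{A}^\ast y-x\|^2_{\Gamma_{\rm pos}^{-1}}\big)=\mathbb{E}\big(\|\widehat{A}^\ast y-\mu_{\rm pos}(y)\|^2_{\Gamma_{\rm pos}^{-1}}\big)+\mathbb{E}\big(\|\mu_{\rm pos}(y)-x\|^2_{\Gamma_{\rm pos}^{-1}}\big)=\sum_{i>r}\delta_i^6+n .$$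
   Context: Bayesian linear model: $y\mid x\sim\mathcal{N}(Gx,\Gamma_{\rm obs})$, $x\sim\mathcal{N}(0,\Gamma_{\rm pr})$, where $G\in\mathbb{R}^{m\times n}$ and $\Gamma_{\rm obs}\in\mathbb{R}^{m\times m}$, $\Gamma_{\rm pr}\in\mathbb{R}^{n\times n}$ are symmetric positive definite; $n$ is the dimension of the parameter space. Set $H=G^\top\Gamma_{\rm obs}^{-1}G$. The posterior of $x$ given $y$ is $\mathcal{N}(\mu_{\rm pos}(y),\Gamma_{\rm pos})$ with $\Gamma_{\rm pos}=(H+\Gamma_{\rm pr}^{-1})^{-1}$ and $\mu_{\rm pos}(y)=\Gamma_{\rm pos}G^\top\Gamma_{\rm obs}^{-1}y$. $\widehat{\mathcal{A}}_r=\{A=(\Gamma_{\rm pr}-B)\,G^\top\Gamma_{\rm obs}^{-1}:\ B\in\mathbb{R}^{n\times n},\ \mathrm{rank}(B)\le r\}$. For a symmetric positive definite $S$, $\|z\|_S^2=z^\top Sz$. Expectations are over the joint distribution of $(x,y)$. The Bayes risk of $Ay$ is $\mathbb{E}\big(\|Ay-x\|^2_{\Gamma_{\rm pos}^{-1}}\big)$. Here $\delta_i^6=(\delta_i^2)^3$. *)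

(* Defs.v *)
From HB Require Import structures.
From mathcomp Require Import all_boot all_order all_algebra.
From mathcomp Require Import all_classical all_reals all_analysis.
Set Implicit Arguments.
Unset Strict Implicit.
Unset Printing Implicit Defensive.
Import Order.TTheory GRing.Theory Num.Theory.
Import numFieldNormedType.Exports.
Local Open Scope classical_set_scope.
Local Open Scope ring_scope.

(* R^n carries the sigma-algebra generated by the coordinate functions (which
   is the Borel one), as the library does for n.-tuple T. *)
Section measurable_colvector.
Context {d} {T : sigmaRingType d} (n : nat).

Let coors : 'I_n -> 'cV[T]_n -> T := fun i v => v i ord0.

Let cV_set0 : g_sigma_preimage coors set0.
Proof. exact: sigma_algebra0. Qed.

Let cV_setC A : g_sigma_preimage coors A -> g_sigma_preimage coors (~` A).
Proof. exact: sigma_algebraC. Qed.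

Let cV_bigcup (F : _^nat) : (forall i, g_sigma_preimage coors (F i)) ->
  g_sigma_preimage coors (\bigcup_i (F i)).
Proof. exact: sigma_algebra_bigcup. Qed.

HB.instance Definition _ := @isMeasurable.Build (measure_tuple_display d)
  'cV[T]_n (g_sigma_preimage coors) cV_set0 cV_setC cV_bigcup.

End measurable_colvector.

Section gaussian_model.
Context {R : realType}.

Definition dotv n (u v : 'cV[R]_n) : R := (u^T *m v) 0 0.

(* ||z||_S^2 *)
Definition sqnorm n (S : 'M[R]_n) (z : 'cV[R]_n) : R := (z^T *m S *m z) 0 0.

Definition spd n (S : 'M[R]_n) : Prop :=
  S^T = S /\ forall z : 'cV[R]_n, z != 0 -> 0 < sqnorm S z.

(* mu is N(a, S), for S symmetric positive definite: every nonzero linear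
   functional u has the univariate normal law N(u^T a, u^T S u) under mu.
   The last argument of normal_prob is the standard deviation; u = 0 is left
   out because its law is the Dirac mass at 0, which normal_prob _ 0 is not. *)
Definition gaussian n (a : 'cV[R]_n) (S : 'M[R]_n)
    (mu : {measure set 'cV[R]_n -> \bar R}) : Prop :=
  forall u : 'cV[R]_n, u != 0 -> forall A : set R, measurable A ->
    mu (dotv u @^-1` A) = normal_prob (dotv u a) (Num.sqrt (sqnorm S u)) A.

(* The kernel k is a regular conditional distribution of Y given X. *)
Definition conditional_law d d1 d2 (T : measurableType d)
    (T1 : measurableType d1) (T2 : measurableType d2) (P : probability T R)
    (X : {RV P >-> T1}) (Y : {RV P >-> T2}) (k : R.-pker T1 ~> T2) : Prop :=
  forall (A : set T1) (B : set T2), measurable A -> measurable B ->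
    P (X @^-1` A `&` Y @^-1` B) = (\int[P]_(t in X @^-1` A) k (X t) B)%E.

(* x ~ N(0, Gpr) and y | x ~ N(G x, Gobs) *)
Definition bayes_linear_model m n (G : 'M[R]_(m, n)) (Gobs : 'M[R]_m)
    (Gpr : 'M[R]_n) d (T : measurableType d) (P : probability T R)
    (x : {RV P >-> 'cV[R]_n}) (y : {RV P >-> 'cV[R]_m}) : Prop :=
  gaussian 0 Gpr (distribution P x) /\
  exists k : R.-pker 'cV[R]_n ~> 'cV[R]_m,
    (forall v, gaussian (G *m v) Gobs (k v)) /\ conditional_law x y k.

Section posterior.
Context m n (G : 'M[R]_(m, n)) (Gobs : 'M[R]_m) (Gpr : 'M[R]_n).

Definition Hmx : 'M[R]_n := G^T *m invmx Gobs *m G.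

Definition post_cov : 'M[R]_n := invmx (Hmx + invmx Gpr).

Definition post_mean (b : 'cV[R]_m) : 'cV[R]_n :=
  post_cov *m G^T *m invmx Gobs *m b.

Definition estimators (r : nat) : set 'M[R]_(n, m) :=
  [set A | exists2 B : 'M[R]_n, (\rank B <= r)%N &
             A = (Gpr - B) *m G^T *m invmx Gobs].

Definition bayes_risk d (T : measurableType d) (P : probability T R)
    (x : T -> 'cV[R]_n) (y : T -> 'cV[R]_m) (A : 'M[R]_(n, m)) : \bar R :=
  ('E_P[fun t => sqnorm (invmx post_cov) (A *m y t - x t)])%E.

(* (lambda i, w i), indexed from 0, are the eigenpairs of (Hmx, Gpr^-1), with
   lambda nonincreasing and w orthonormal for Gpr^-1. *)
Definition pencil_eigenpairs (lambda : 'I_n -> R) (w : 'I_n -> 'cV[R]_n)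
    : Prop :=
  [/\ forall i, Hmx *m w i = lambda i *: (invmx Gpr *m w i),
      forall i j : 'I_n, (i <= j)%N -> lambda j <= lambda i
    & forall i j, ((w i)^T *m invmx Gpr *m w j) 0 0 = (i == j)%:R].

Definition post_cov_approx (lambda : 'I_n -> R) (w : 'I_n -> 'cV[R]_n)
    (r : nat) : 'M[R]_n :=
  Gpr - \sum_(i < n | (i < r)%N)
          (lambda i * (1 + lambda i)^-1) *: (w i *m (w i)^T).

End posterior.
End gaussian_model.

(* Main.v *)
Require Import Defs.
From HB Require Import structures.
From mathcomp Require Import all_boot all_order all_algebra.
From mathcomp Require Import ring lra.
From mathcomp Require Import all_classical all_reals all_analysis.
From mathcomp Require Import measurable_realfun.
Set Implicit Arguments.
Unset Strict Implicit.
Unset Printing Implicit Defensive.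
Import Order.TTheory GRing.Theory Num.Theory.
Import numFieldNormedType.Exports.
Local Open Scope classical_set_scope.
Local Open Scope ring_scope.

(** Write [W] for the matrix whose columns are the eigenvectors, [Delta] for
    the diagonal matrix of the eigenvalues, and [D = 1 + Delta].  The
    orthonormality of the eigenvectors for the prior precision says that
    [W W^T] is the prior covariance, and the eigenvalue equation that
    [W^T H W = Delta]; hence in the coordinates given by [W] the prior
    covariance, the Hessian and the posterior covariance become [1], [Delta] and
    [D^-1], and the posterior precision, which defines the loss, becomes [D].

    For an estimator [A = W C W^T G^T Gobs^-1] and a scalar [e], the expected
    loss of [A y - e x] only involves the second moments of linear functionals
    of [(x, y)].  Completing the square turns it into
    [e^2 n + sum_ij d_i d_j lambda_j (C_ij - e [i = j] / d_i)^2]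
    ([expectation_estimator]).  All three expectations of the theorem are
    instances: [e = 1] gives the risk, [e = 1] and [C = D^-1] gives the risk [n]
    of the posterior mean, and [e = 0] gives the mean squared distance between
    two estimators, which is why the risk splits orthogonally.

    An admissible estimator has [C = 1 - B] with [rank B <= r], so that, after
    conjugation by diagonal matrices, its excess risk over [n] is the squared
    Frobenius distance of [Delta^(3/2)] to a matrix of rank at most [r].  The
    Eckart-Young bound ([eckart_young_diag]) says that this is at least the
    sum of the [lambda_i^3] with [i >= r]; truncation of the diagonal, which is
    the estimator of the theorem, attains it.

    The second moments come from moment generating functions.  The one of a
    normal law is computed by exponential tilting ([normal_mgf]); conditioning
    then gives the one of every linear functional of [(x, y)] ([joint_mgf]),
    because the exponential of [a.x + b.y] is a product of a function of [x] and
    a function of [y], to which the identity that defines a conditional law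
    extends; and the second moment is recovered from it by a symmetric
    second difference at [0] ([second_moment_of_mgf]). *)

(** * Mixtures of measures *)

Section mixtures.
Import HBNNSimple.
Local Open Scope ereal_scope.
Context d dZ (T : measurableType d) (Z : measurableType dZ) (R : realType).
Variable mu : {measure set T -> \bar R}.
Variables (phi : T -> R) (kappa : T -> {measure set Z -> \bar R}).
Hypothesis phi0 : forall t, (0 <= phi t)%R.
Hypothesis mphi : measurable_fun [set: _] phi.
Hypothesis mkappa : forall B, measurable B -> measurable_fun [set: T] (kappa ^~ B).

Lemma integral_mixture_nnsfun (h : {nnsfun Z >-> R}) :
  \int[mu]_t ((phi t)%:E * \int[kappa t]_z (h z)%:E) =
  \sum_(r \in range h)
    r%:E * \int[mu]_t ((phi t)%:E * kappa t (h @^-1` [set r])).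
Proof.
have mpk r : measurable_fun [set: _]
    (fun t => (phi t)%:E * kappa t (h @^-1` [set r])).
  by apply: emeasurable_funM; [exact/measurable_EFinP|exact: mkappa].
under eq_integral => t _.
  rewrite integralT_nnsfun sintegralE ge0_mule_fsumr; last first.
    by move=> r; exact: nnsfun_mulemu_ge0.
  under eq_fsbigr do rewrite muleCA.
  over.
rewrite ge0_integral_fsum//; first last.
- by move=> r t _; rewrite muleCA mule_ge0 ?lee_fin//; exact: nnsfun_mulemu_ge0.
- by move=> r; exact: measurable_funeM.
apply: eq_fsbigr => r; rewrite inE => -[z _ <-].
rewrite ge0_integralZl// ?lee_fin//.
by move=> t _; rewrite mule_ge0 ?lee_fin.
Qed.

(** Monotone convergence, used twice: inside [kappa t] and then under [mu].  The
    approximating functions depend on [h] alone, which is what allows two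
    different mixtures to be compared. *)
Lemma integral_mixture_lim (h : Z -> \bar R) (mh : measurable_fun [set: _] h) :
  (forall z, 0 <= h z) ->
  \int[mu]_t ((phi t)%:E * \int[kappa t]_z h z) =
  limn (fun n => \int[mu]_t
    ((phi t)%:E * \int[kappa t]_z (nnsfun_approx measurableT mh n z)%:E)).
Proof.
move=> h0; pose h_ := nnsfun_approx measurableT mh.
have h_nd z : {homo (h_ ^~ z) : a b / (a <= b)%N >-> (a <= b)%R}.
  by move=> a b ab; exact/lefP/nd_nnsfun_approx.
have nd_int t :
    nondecreasing_seq (fun n => \int[kappa t]_z (h_ n z)%:E).
  move=> a b ab; apply: ge0_le_integral => //.
  - by move=> z _; rewrite lee_fin.
  - exact/measurable_EFinP.
  - exact/measurable_EFinP.
  - by move=> z _; rewrite lee_fin h_nd.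
have int_ge0 n t : 0 <= \int[kappa t]_z (h_ n z)%:E.
  by apply: integral_ge0 => z _; rewrite lee_fin.
have limE t : \int[kappa t]_z h z = limn (fun n => \int[kappa t]_z (h_ n z)%:E).
  rewrite -monotone_convergence//.
  - by apply: eq_integral => z _; apply/esym/cvg_lim => //; exact: cvg_nnsfun_approx.
  - by move=> n; exact/measurable_EFinP.
  - by move=> n z _; rewrite lee_fin.
  - by move=> z _ a b ab; rewrite lee_fin h_nd.
rewrite -monotone_convergence//.
- apply: eq_integral => t _; rewrite limE; apply/esym/cvg_lim => //.
  by apply: cvgeZl => //; exact: ereal_nondecreasing_is_cvgn.
- move=> n; apply: emeasurable_funM; first exact/measurable_EFinP.
  apply: measurable_fun_integral_kernel => //; last exact/measurable_EFinP.
  by move=> z; rewrite lee_fin.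
- by move=> n t _; rewrite mule_ge0 ?lee_fin.
- by move=> t _ a b ab; apply: lee_wpmul2l; [rewrite lee_fin|exact: nd_int].
Qed.

End mixtures.

Section eq_mixture.
Import HBNNSimple.

(** Two weighted mixtures of measures that agree on measurable sets integrate
    nonnegative functions in the same way: by the two lemmas above both integrals
    are limits of the same finite combinations of measures of sets.  With Dirac
    kernels it yields the density formula for the normal law, the change of
    variables along a random variable, and the disintegration formula. *)
Lemma eq_integral_mixture d d' dZ (T : measurableType d) (T' : measurableType d')
    (Z : measurableType dZ) (R : realType)
    (mu : {measure set T -> \bar R}) (mu' : {measure set T' -> \bar R})
    (phi : T -> R) (phi' : T' -> R)
    (kappa : T -> {measure set Z -> \bar R})
    (kappa' : T' -> {measure set Z -> \bar R}) (h : Z -> \bar R) :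
  (forall t, 0 <= phi t) -> measurable_fun [set: _] phi ->
  (forall t, 0 <= phi' t) -> measurable_fun [set: _] phi' ->
  (forall B, measurable B -> measurable_fun [set: T] (kappa ^~ B)) ->
  (forall B, measurable B -> measurable_fun [set: T'] (kappa' ^~ B)) ->
  (forall B, measurable B ->
    \int[mu]_t ((phi t)%:E * kappa t B) =
    \int[mu']_t ((phi' t)%:E * kappa' t B))%E ->
  measurable_fun [set: _] h -> (forall z, 0 <= h z)%E ->
  (\int[mu]_t ((phi t)%:E * \int[kappa t]_z h z) =
   \int[mu']_t ((phi' t)%:E * \int[kappa' t]_z h z))%E.
Proof.
move=> phi0 mphi phi'0 mphi' mk mk' eqB mh h0.
rewrite (integral_mixture_lim mu phi0 mphi mk mh h0).
rewrite (integral_mixture_lim mu' phi'0 mphi' mk' mh h0).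
congr (limn _); apply/funext => n.
rewrite integral_mixture_nnsfun// integral_mixture_nnsfun//.
by apply: eq_fsbigr => r _; rewrite eqB.
Qed.

End eq_mixture.

(** * Moment generating functions of normal laws *)

Section normal_mgf.
Context {R : realType}.
Implicit Types m s t : R.

(** The law on the left is a mixture over a point, the one on the right a
    mixture of Dirac masses weighted by the density. *)
Lemma integral_normal_prob m s (h : R -> \bar R) :
  measurable_fun [set: R] h -> (forall z, 0 <= h z)%E ->
  (\int[normal_prob m s]_z h z =
   \int[lebesgue_measure]_z ((normal_pdf m s z)%:E * h z))%E.
Proof.
move=> mh h0.
transitivity (\int[dirac tt]_(_ in [set: unit])
    (1%:E * \int[normal_prob m s]_z h z))%E.
  by rewrite integral_dirac// diracT !mul1e.
rewrite (@eq_integral_mixture _ _ _ _ (measurableTypeR R) (measurableTypeR R) R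
  (dirac tt) lebesgue_measure (fun=> 1) (normal_pdf m s) (fun=> normal_prob m s)
  (fun z => dirac z) h)//.
- by apply: eq_integral => z _; rewrite integral_dirac// diracT mul1e.
- exact: normal_pdf_ge0.
- exact: measurable_normal_pdf.
- by move=> B mB; exact: measurable_fun_dirac.
- move=> B mB; rewrite integral_dirac// diracT !mul1e /normal_prob.
  rewrite [LHS]integral_mkcond; apply: eq_integral => z _.
  rewrite /= diracE patchE; case: ifPn => zB.
    by rewrite mule1.
  by rewrite mule0.
Qed.

(** Exponential tilting: completing the square shows that multiplying a normal
    density by an exponential shifts its mean, up to a constant. *)
Lemma normal_pdf_tilt m s t z : s != 0 ->
  normal_pdf m s z * expR (t * z) =
  expR (t * m + t ^+ 2 * s ^+ 2 / 2) * normal_pdf (m + t * s ^+ 2) s z.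
Proof.
move=> s0; rewrite !normal_pdfE//=.
rewrite mulrCA -[LHS]mulrA /normal_fun -!expRD; congr (_ * expR _).
by field.
Qed.

Lemma normal_mgf m s t : s != 0 ->
  (\int[normal_prob m s]_z (expR (t * z))%:E =
   (expR (t * m + t ^+ 2 * s ^+ 2 / 2))%:E)%E.
Proof.
move=> s0; rewrite integral_normal_prob//; last first.
  by apply/measurable_EFinP; exact: measurableT_comp.
under eq_integral do rewrite -EFinM normal_pdf_tilt// EFinM.
have mpdf : measurable_fun [set: R] (EFin \o normal_pdf (m + t * s ^+ 2) s).
  by apply/measurable_EFinP; exact: measurable_normal_pdf.
rewrite ge0_integralZl_EFin ?expR_ge0//=.
  by rewrite integral_normal_pdf mule1.
by move=> z _; rewrite lee_fin normal_pdf_ge0.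
Qed.

End normal_mgf.

Section gaussian_vectors.
Context {R : realType}.

Lemma measurable_coord n (i : 'I_n) :
  measurable_fun [set: 'cV[R]_n] (fun v : 'cV[R]_n => v i ord0).
Proof.
move=> _ Y mY; rewrite setTI; apply: sub_sigma_algebra => /=.
rewrite -bigcup_seq/=; exists i => /=; first by rewrite mem_index_enum.
by exists Y => //; rewrite setTI.
Qed.

Lemma dotvE n (u v : 'cV[R]_n) : dotv u v = \sum_i u i ord0 * v i ord0.
Proof. by rewrite /dotv mxE; apply: eq_bigr => i _; rewrite mxE. Qed.

Lemma dotv_mulmx m n (G : 'M[R]_(m, n)) b v :
  dotv b (G *m v) = dotv (G^T *m b) v.
Proof. by rewrite /dotv trmx_mul trmxK mulmxA. Qed.

Lemma dotvDl n (a b v : 'cV[R]_n) : dotv (a + b) v = dotv a v + dotv b v.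
Proof. by rewrite /dotv [(a + b)^T]linearD/= mulmxDl [LHS]mxE. Qed.

Lemma measurable_dotv n (u : 'cV[R]_n) : measurable_fun [set: 'cV[R]_n] (dotv u).
Proof.
rewrite (_ : dotv u = fun v => \sum_i u i ord0 * v i ord0); last first.
  by apply/funext => v; rewrite dotvE.
apply: measurable_sum => i; apply: measurable_funM => //.
exact: measurable_coord.
Qed.

(** For [u != 0] this is [normal_mgf] at [1] for the law of [dotv u]; the case
    [u = 0], about which [gaussian] says nothing, is the total mass. *)
Lemma gaussian_mgf n (a : 'cV[R]_n) (S : 'M[R]_n)
    (mu : {measure set 'cV[R]_n -> \bar R}) :
  spd S -> mu [set: 'cV[R]_n] = 1%E -> gaussian a S mu ->
  forall u : 'cV[R]_n,
  (\int[mu]_z (expR (dotv u z))%:E =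
   (expR (dotv u a + sqnorm S u / 2))%:E)%E.
Proof.
move=> [_ Spos] mu1 gmu u; have [->|u0] := eqVneq u 0.
  rewrite (eq_integral (cst 1%E)); last first.
    by move=> z _; rewrite /dotv trmx0 mul0mx mxE expR0.
  rewrite integral_cst// mu1 mule1.
  by rewrite /dotv /sqnorm trmx0 !mul0mx !mxE mul0r addr0 expR0.
pose f : 'cV[R]_n -> measurableTypeR R := dotv u.
have mf : measurable_fun [set: 'cV[R]_n] f by move=> _ B mB; exact: measurable_dotv.
pose s := Num.sqrt (sqnorm S u).
have mE : measurable_fun [set: measurableTypeR R] (fun z : R => (expR z)%:E).
  by apply/measurable_EFinP.
transitivity (\int[mu]_z
    (1%:E * \int[dirac (f z)]_y (expR y)%:E))%E.
  by apply: eq_integral => z _; rewrite integral_dirac// diracT !mul1e.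
have mdf (B : set (measurableTypeR R)) : measurable B ->
    measurable_fun [set: 'cV[R]_n] (fun z => @dirac _ _ (f z) R B).
  by move=> mB; apply: (measurableT_comp (measurable_fun_dirac mB) mf).
rewrite (@eq_integral_mixture _ _ _ _ unit (measurableTypeR R) R
  mu (dirac tt) (fun=> 1) (fun=> 1) (fun z => dirac (f z))
  (fun=> normal_prob (dotv u a) s) (EFin \o expR))//; last first.
- by move=> z; rewrite lee_fin expR_ge0.
- move=> B mB; transitivity (mu (f @^-1` B)).
    have mfB : measurable (f @^-1` B) by rewrite -[X in measurable X]setTI; exact: mf.
    rewrite -[X in _ = mu X]setIT -integral_indic//.
    by apply: eq_integral => z _; rewrite mul1e /= diracE indicE.
  by rewrite integral_dirac// diracT !mul1e; exact: gmu.
rewrite integral_dirac// diracT !mul1e.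
transitivity (\int[normal_prob (dotv u a) s]_z (expR (1 * z))%:E)%E.
  by apply: eq_integral => z _; rewrite mul1r.
rewrite normal_mgf; first by rewrite mul1r expr1n mul1r sqr_sqrtr// ltW// Spos.
by rewrite gt_eqF// sqrtr_gt0 Spos.
Qed.

End gaussian_vectors.

(** * Disintegration and the joint law of parameter and data *)

Section disintegration.
Context {R : realType} {d d1 d2} {T : measurableType d}
  {T1 : measurableType d1} {T2 : measurableType d2} {P : probability T R}.
Variables (X : {RV P >-> T1}) (Y : {RV P >-> T2}) (k : R.-pker T1 ~> T2).
Hypothesis XYk : conditional_law X Y k.

(** The defining identity of a conditional law is about products of
    indicators.  It is extended first in [Y], with the indicator of an event on
    [X] kept as a weight, and then in [X], with [h (Y t)] and [H (X t)] as
    weights. *)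
Lemma integral_conditional_law (g H : T1 -> R) (h : T2 -> R) :
  (forall u, 0 <= g u) -> measurable_fun [set: T1] g ->
  (forall v, 0 <= h v) -> measurable_fun [set: T2] h ->
  (forall u, 0 <= H u) -> measurable_fun [set: T1] H ->
  (forall u, \int[k u]_v (h v)%:E = (H u)%:E)%E ->
  (\int[P]_t (g (X t) * h (Y t))%:E = \int[P]_t (g (X t) * H (X t))%:E)%E.
Proof.
move=> g0 mg h0 mh H0 mH kh.
have mX : measurable_fun [set: T] X by [].
have mY : measurable_fun [set: T] Y by [].
have mdX (A : set T1) : measurable A ->
    measurable_fun [set: T] (fun t => @dirac _ _ (X t) R A).
  by move=> mA; apply: (measurableT_comp (measurable_fun_dirac mA) mX).
have mdY (B : set T2) : measurable B ->
    measurable_fun [set: T] (fun t => @dirac _ _ (Y t) R B).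
  by move=> mB; apply: (measurableT_comp (measurable_fun_dirac mB) mY).
have mkX (B : set T2) : measurable B -> measurable_fun [set: T] (fun t => k (X t) B).
  by move=> mB; apply: (measurableT_comp (measurable_kernel k _ mB) mX).
have mpre (A : set T1) : measurable A -> measurable (X @^-1` A).
  by move=> mA; rewrite -[X in measurable X]setTI; exact: mX.
have mpreY (B : set T2) : measurable B -> measurable (Y @^-1` B).
  by move=> mB; rewrite -[X in measurable X]setTI; exact: mY.
have mhY : measurable_fun [set: T] (h \o Y) by exact: measurableT_comp.
have mHX : measurable_fun [set: T] (H \o X) by exact: measurableT_comp.
have meg : measurable_fun [set: T1] (EFin \o g) by exact/measurable_EFinP.
have meh : measurable_fun [set: T2] (EFin \o h) by exact/measurable_EFinP.
have hY0 t : 0 <= (h \o Y) t by exact: h0.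
have HX0 t : 0 <= (H \o X) t by exact: H0.
(* the identity extended in Y, for an event on X *)
have stepY (A : set T1) : measurable A ->
    (\int[P]_t ((h (Y t))%:E * \d_(X t) A) =
     \int[P]_t ((H (X t))%:E * \d_(X t) A))%E.
  move=> mA.
  have := @eq_integral_mixture _ _ _ T T T2 R P P (\1_(X @^-1` A)) (\1_(X @^-1` A))
    (fun t => dirac (Y t)) (fun t => k (X t)) (EFin \o h).
  move=> E; transitivity
    (\int[P]_t ((\1_(X @^-1` A) t)%:E * \int[dirac (Y t)]_v (h v)%:E))%E.
    apply: eq_integral => t _; rewrite integral_dirac//.
    by rewrite diracT mul1e muleC diracE indicE.
  rewrite E//; last 3 first.
  - exact: measurable_indic (mpre _ mA).
  - exact: measurable_indic (mpre _ mA).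
  - move=> B mB; transitivity (P (X @^-1` A `&` Y @^-1` B)).
      rewrite -[X in _ = P X]setIT -integral_indic//; last first.
        by apply: measurableI; [exact: mpre|exact: mpreY].
      by apply: eq_integral => t _; rewrite /= diracE indicI -EFinM !indicE.
    rewrite XYk// [LHS]integral_mkcond; apply: eq_integral => t _.
    rewrite patchE indicE; case: ifPn => _; first by rewrite mul1e.
    by rewrite mul0e.
  by apply: eq_integral => t _; rewrite /= kh muleC diracE indicE.
have := @eq_integral_mixture _ _ _ T T T1 R P P (h \o Y) (H \o X)
  (fun t => dirac (X t)) (fun t => dirac (X t)) (EFin \o g).
have gE t : (\int[dirac (X t)]_u (g u)%:E = (g (X t))%:E)%E.
  rewrite integral_dirac//.
  by rewrite diracT mul1e.
move=> E; transitivity (\int[P]_t ((h (Y t))%:E * \int[dirac (X t)]_v (g v)%:E))%E.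
  by apply: eq_integral => t _; rewrite gE -EFinM mulrC.
rewrite E//.
by apply: eq_integral => t _; rewrite /= gE -EFinM mulrC.
Qed.
End disintegration.

Section joint_law.
Context {R : realType} m n (G : 'M[R]_(m, n)) (Gobs : 'M[R]_m)
  (Gpr : 'M[R]_n) d (T : measurableType d) (P : probability T R)
  (x : {RV P >-> 'cV[R]_n}) (y : {RV P >-> 'cV[R]_m}).
Hypothesis hGobs : spd Gobs.
Hypothesis hGpr : spd Gpr.
Hypothesis hmodel : bayes_linear_model G Gobs Gpr x y.

(** The variance of [a.x + b.y]: given [x], this functional has mean
    [(a + G^T b).x] and variance [b^T Gobs b]. *)
Definition joint_var (a : 'cV[R]_n) (b : 'cV[R]_m) : R :=
  sqnorm Gpr (a + G^T *m b) + sqnorm Gobs b.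

Lemma joint_mgf (a : 'cV[R]_n) (b : 'cV[R]_m) :
  (\int[P]_t (expR (dotv a (x t) + dotv b (y t)))%:E =
   (expR (joint_var a b / 2))%:E)%E.
Proof.
have [gx [k [gk xyk]]] := hmodel.
have mexp p (u : 'cV[R]_p) : measurable_fun [set: 'cV[R]_p] (fun v => expR (dotv u v)).
  by apply: measurableT_comp => //; exact: measurable_dotv.
pose c := expR (sqnorm Gobs b / 2).
have kE v : (\int[k v]_z (expR (dotv b z))%:E =
    (expR (dotv (G^T *m b) v) * c)%:E)%E.
  rewrite (gaussian_mgf hGobs (prob_kernel v) (gk v)) -expRD.
  by rewrite dotv_mulmx.
have mH : measurable_fun [set: 'cV[R]_n] (fun v => expR (dotv (G^T *m b) v) * c).
  by apply: measurable_funM => //; exact: mexp.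
under eq_integral do rewrite expRD.
rewrite (integral_conditional_law xyk _ (mexp _ a) _ (mexp _ b) _ mH kE); last 3 first.
- by move=> u; exact: expR_ge0.
- by move=> u; exact: expR_ge0.
- by move=> u; rewrite mulr_ge0 ?expR_ge0.
have sE v : expR (dotv a v) * (expR (dotv (G^T *m b) v) * c) =
    c * expR (dotv (a + G^T *m b) v).
  rewrite mulrA mulrC; congr (_ * _).
  by rewrite -expRD dotvDl.
under eq_integral do rewrite sE EFinM.
have mex : measurable_fun [set: 'cV[R]_n]
    (fun v => (expR (dotv (a + G^T *m b) v))%:E).
  by apply/measurable_EFinP; exact: mexp.
have mexx : measurable_fun [set: T]
    (fun t => (expR (dotv (a + G^T *m b) (x t)))%:E).
  exact: (measurableT_comp mex (measurable_funPT x)).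
rewrite ge0_integralZl_EFin ?expR_ge0//.
rewrite -[X in (_ * X)%E](@ge0_integral_distribution _ _ _ _ _ P x _ mex); last first.
  by move=> v; rewrite lee_fin expR_ge0.
rewrite (gaussian_mgf hGpr (probability_setT (distribution P x)) gx).
rewrite -EFinM -expRD /joint_var; congr (expR _)%:E.
by rewrite [dotv _ 0]/dotv mulmx0 mxE; field.
Qed.

End joint_law.

(** * Second moments from moment generating functions *)

Section second_moment.
Context {R : realType}.

(** Both bounds are [1 + u <= expR u], at [u = t c] and at [u = - t c]. *)
Lemma expR_slope_bounds (c t : R) : 0 < t ->
  c <= (expR (t * c) - 1) / t <= c * expR (t * c).
Proof.
move=> t0; rewrite ler_pdivlMr// ler_pdivrMr//; apply/andP; split.
  by rewrite lerBrDl mulrC expR_ge1Dx.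
have h : (1 - t * c) * expR (t * c) <= 1.
  rewrite -[leRHS](expRxMexpNx_1 (t * c)) [leRHS]mulrC.
  by rewrite ler_wpM2r ?expR_ge0// expR_ge1Dx.
by lra.
Qed.

Lemma cvg_expR_slope (c : R) (t : nat -> R) : (forall n, 0 < t n) ->
  t @ \oo --> 0 -> (expR (t n * c) - 1) / t n @[n --> \oo] --> c.
Proof.
move=> t0 tcvg.
apply: (@squeeze_cvgr _ _ _ _ (cst c) (fun n => c * expR (t n * c))).
- by apply: nearW => n; exact: expR_slope_bounds.
- exact: cvg_cst.
- rewrite -[X in _ --> X]mulr1; apply: (cvgM (cvg_cst c)).
  rewrite -expR0 -(mul0r c); apply: (cvg_comp (fun n => t n * c) expR).
    exact: (cvgM tcvg (cvg_cst c)).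
  exact: continuous_expR.
Qed.

(** The symmetric second difference at [0], with step [t], of
    [s |-> expR (s z)]. *)
Definition second_diff (t z : R) : R :=
  (expR (t * z) + expR (- t * z) - 2) / t ^+ 2.

(** The second difference is a square: this gives its sign, its limit and its
    domination at once. *)
Lemma second_diffE (t z : R) : t != 0 ->
  second_diff t z = ((expR (t * (z / 2)) - expR (t * - (z / 2))) / t) ^+ 2.
Proof.
move=> t0; rewrite /second_diff exprMn exprVn; congr (_ / _).
have -> : t * z = t * (z / 2) + t * (z / 2) by field.
have -> : - t * z = t * - (z / 2) + t * - (z / 2) by field.
rewrite !expRD.
have h : expR (t * (z / 2)) * expR (t * - (z / 2)) = 1.
  by rewrite mulrN expRxMexpNx_1.
by rewrite sqrrB -!expr2 mulr2n h; ring.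
Qed.

Lemma second_diff_ge0 (t z : R) : t != 0 -> 0 <= second_diff t z.
Proof. by move=> t0; rewrite second_diffE// sqr_ge0. Qed.

Lemma cvg_second_diff (z : R) (t : nat -> R) : (forall n, 0 < t n) ->
  t @ \oo --> 0 -> second_diff (t n) z @[n --> \oo] --> z ^+ 2.
Proof.
move=> t0 tcvg.
under eq_fun do rewrite second_diffE ?gt_eqF//.
have -> : z ^+ 2 = (z / 2 - - (z / 2)) ^+ 2 by field.
have sE n : (expR (t n * (z / 2)) - expR (t n * - (z / 2))) / t n =
    (expR (t n * (z / 2)) - 1) / t n - (expR (t n * - (z / 2)) - 1) / t n.
  by rewrite -mulrBl; congr (_ / _); ring.
under eq_fun do rewrite sE.
rewrite expr2; under eq_fun do rewrite expr2.
by apply: cvgM; apply: cvgB; exact: cvg_expR_slope.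
Qed.

Lemma second_diff_le (t z : R) : 0 < t <= 1 ->
  second_diff t z <= expR (4 * z) + expR (- 4 * z).
Proof.
move=> /andP[t0 t1].
wlog z0 : z / 0 <= z.
  move=> h; have [/h//|/ltW z0] := leP 0 z.
  have := h (- z); rewrite oppr_ge0 => /(_ z0).
  rewrite [second_diff t (- z)]/second_diff !mulrN !mulNr !opprK.
  by rewrite [X in X - 2]addrC [X in _ <= X -> _]addrC /second_diff !mulNr.
rewrite second_diffE ?gt_eqF//.
set D := _ / t.
have D0 : 0 <= D.
  rewrite divr_ge0 ?(ltW t0)// subr_ge0 ler_expR ler_wpM2l ?(ltW t0)//.
  by rewrite (le_trans (y := 0))// ?oppr_le0 divr_ge0.
have Dle : D <= expR (2 * z).
  have -> : D = expR (t * - (z / 2)) * ((expR (t * z) - 1) / t).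
    rewrite /D [RHS]mulrA; congr (_ / _); rewrite mulrBr mulr1 -expRD; congr (expR _ - _).
    by field.
  rewrite -[leRHS]mul1r; apply: ler_pM; rewrite ?expR_ge0//.
  - rewrite divr_ge0 ?(ltW t0)// subr_ge0 -expR0 ler_expR.
    by rewrite mulr_ge0// ltW.
  - rewrite -expR0 ler_expR mulrN oppr_le0.
    by rewrite mulr_ge0 ?divr_ge0// ltW.
  have /andP[_ /le_trans->//] := expR_slope_bounds z t0.
  have -> : 2 * z = z + z by ring.
  rewrite expRD ler_pM ?expR_ge0//.
    by rewrite (le_trans _ (expR_ge1Dx z))// lerDr.
  by rewrite ler_expR ler_piMl.
apply: (@le_trans _ _ (expR (4 * z))); last by rewrite lerDl expR_ge0.
have -> : 4 * z = 2 * z + 2 * z by ring.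
by rewrite expRD expr2 ler_pM.
Qed.

(** The second difference at [0] of the moment generating function, divided by
    the square of the step, converges to its second derivative [2 v]; it is also
    the expectation of [second_diff t Z], which converges to that of [Z ^+ 2] by
    dominated convergence. *)
Lemma second_moment_of_mgf d (T : measurableType d) (P : probability T R)
    (Z : T -> R) (v : R) : measurable_fun [set: T] Z ->
  (forall t, \int[P]_w (expR (t * Z w))%:E = (expR (t ^+ 2 * v))%:E)%E ->
  (\int[P]_w (Z w ^+ 2)%:E = (2 * v)%:E)%E.
Proof.
move=> mZ mgf; pose t n : R := n.+1%:R^-1.
have t0 n : 0 < t n by rewrite invr_gt0 ltr0n.
have t1 n : t n <= 1 by rewrite invf_le1 ?ltr0n// ler1n.
have tcvg : t @ \oo --> 0 by exact: cvg_harmonic.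
have me s : measurable_fun [set: T] (fun w => expR (s * Z w)).
  by apply: measurableT_comp => //; exact: measurable_funM.
have ie s : P.-integrable [set: T] (fun w => (expR (s * Z w))%:E).
  apply/integrableP; split; first exact/measurable_EFinP.
  by under eq_integral do rewrite gee0_abs ?lee_fin ?expR_ge0//; rewrite mgf ltry.
have int_sd n : (\int[P]_w (second_diff (t n) (Z w))%:E =
    (2 * ((expR (t n ^+ 2 * v) - 1) / t n ^+ 2))%:E)%E.
  rewrite /second_diff; under eq_integral do rewrite mulrC EFinM EFinB EFinD.
  have i2 : P.-integrable [set: T] (fun=> 2%:E) by exact: finite_measure_integrable_cst.
  have iee := integrableD measurableT (ie (t n)) (ie (- t n)).
  rewrite integralZl//; last exact: integrableB.
  rewrite integralB// integralD// !mgf integral_cst//.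
  rewrite [X in (_ - _ * X)%E]probability_setT mule1 sqrrN -EFinD -EFinM; congr (_%:E).
  by field; rewrite gt_eqF.
have lim1 : (\int[P]_w (second_diff (t n) (Z w))%:E @[n --> \oo] -->
    \int[P]_w (Z w ^+ 2)%:E)%E.
  (* second_diff_le is available because all the steps are at most 1 *)
  apply: (@dominated_cvg _ _ _ P _ measurableT _ _
    (fun w => (expR (4 * Z w) + expR (- 4 * Z w))%:E)) => //.
  - move=> n; apply/measurable_EFinP; apply: measurable_funM => //.
    by apply: measurable_funB => //; apply: measurable_funD.
  - by move=> w _; apply/fine_cvgP; split; [exact: nearW|exact: cvg_second_diff].
  - under eq_fun do rewrite EFinD. exact: integrableD.
  - move=> n w _; rewrite gee0_abs ?lee_fin ?second_diff_le ?t0 ?t1//.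
    by rewrite second_diff_ge0 ?gt_eqF.
have lim2 : (\int[P]_w (second_diff (t n) (Z w))%:E @[n --> \oo] --> (2 * v)%:E)%E.
  under eq_fun do rewrite int_sd.
  apply/fine_cvgP; split; first exact: nearW.
  apply: (cvgM (cvg_cst _)); apply: (@cvg_expR_slope v (fun n => t n ^+ 2)).
    by move=> n; rewrite exprn_gt0.
  rewrite -[X in _ --> X](mulr0 0); under eq_fun do rewrite expr2.
  exact: cvgM.
exact: cvg_unique lim1 lim2.
Qed.
End second_moment.

Section joint_second_moment.
Context {R : realType} m n (G : 'M[R]_(m, n)) (Gobs : 'M[R]_m)
  (Gpr : 'M[R]_n) d (T : measurableType d) (P : probability T R)
  (x : {RV P >-> 'cV[R]_n}) (y : {RV P >-> 'cV[R]_m}).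
Hypothesis hGobs : spd Gobs.
Hypothesis hGpr : spd Gpr.
Hypothesis hmodel : bayes_linear_model G Gobs Gpr x y.

Lemma dotvZl p (c : R) (u v : 'cV[R]_p) : dotv (c *: u) v = c * dotv u v.
Proof. by rewrite /dotv [(c *: u)^T]linearZ/= -scalemxAl mxE. Qed.

Lemma sqnormZ p (S : 'M[R]_p) (c : R) (u : 'cV[R]_p) :
  sqnorm S (c *: u) = c ^+ 2 * sqnorm S u.
Proof.
rewrite /sqnorm [(c *: u)^T]linearZ/= -!scalemxAl -scalemxAr.
by rewrite [LHS]mxE [X in c * X]mxE mulrA expr2.
Qed.

Lemma measurable_joint (a : 'cV[R]_n) (b : 'cV[R]_m) :
  measurable_fun [set: T] (fun t => dotv a (x t) + dotv b (y t)).
Proof.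
apply: measurable_funD.
  exact: (measurableT_comp (measurable_dotv a) (measurable_funPT x)).
exact: (measurableT_comp (measurable_dotv b) (measurable_funPT y)).
Qed.

(** [joint_mgf], applied to the multiples of [a] and [b], provides the moment
    generating function of [a.x + b.y]. *)
Lemma joint_second_moment (a : 'cV[R]_n) (b : 'cV[R]_m) :
  (\int[P]_t ((dotv a (x t) + dotv b (y t)) ^+ 2)%:E =
   (joint_var G Gobs Gpr a b)%:E)%E.
Proof.
have mgf t : (\int[P]_w (expR (t * (dotv a (x w) + dotv b (y w))))%:E =
    (expR (t ^+ 2 * (joint_var G Gobs Gpr a b / 2)))%:E)%E.
  under eq_integral do rewrite mulrDr -!dotvZl.
  rewrite (joint_mgf hGobs hGpr hmodel) /joint_var.
  by rewrite -scalemxAr -scalerDr !sqnormZ -mulrDr mulrA.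
rewrite (second_moment_of_mgf (measurable_joint a b) mgf).
by congr (_%:E); field.
Qed.

End joint_second_moment.

(** * Low-rank approximation of a diagonal matrix *)

Section eckart_young.
Context {R : realFieldType}.

Lemma mxtrace_gram_ge0 m n (A : 'M[R]_(m, n)) : 0 <= \tr (A *m A^T).
Proof.
rewrite /mxtrace sumr_ge0// => i _; rewrite mxE sumr_ge0// => j _.
by rewrite mxE -expr2 sqr_ge0.
Qed.

Lemma mxtrace_gram m n (A : 'M[R]_(m, n)) :
  \tr (A *m A^T) = \sum_i \sum_j A i j ^+ 2.
Proof.
by apply: eq_bigr => i _; rewrite mxE; apply: eq_bigr => j _; rewrite mxE expr2.
Qed.

Lemma gram_unitmx k n (K : 'M[R]_(k, n)) : row_free K -> K *m K^T \in unitmx.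
Proof.
move=> Kfree; rewrite -row_free_unit; apply: inj_row_free => v vKK.
suff /eqP : v *m K = 0 by rewrite mulmx_free_eq0// => /eqP.
apply/matrixP => i j; rewrite ord1 [RHS]mxE.
have : \tr ((v *m K) *m (v *m K)^T) = 0.
  by rewrite trmx_mul mulmxA -(mulmxA v) vKK mul0mx mxtrace0.
rewrite mxtrace_gram big_ord1 => /eqP.
rewrite psumr_eq0 => [|? _]; last exact: sqr_ge0.
by move=> /allP/(_ j); rewrite mem_index_enum => /(_ isT) /=; rewrite sqrf_eq0 => /eqP.
Qed.

(** The orthogonal projector onto the orthogonal complement of the row space of
    [B].  If the rows of [K] form a basis of that complement, it is
    [K^T (K K^T)^-1 K]. *)
Lemma exists_kernel_projector n (B : 'M[R]_n) :
  exists Q : 'M[R]_n,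
    [/\ Q^T = Q, Q *m Q = Q, B *m Q = 0 & \tr Q = (n - \rank B)%:R].
Proof.
have [K [Kfree BK]] : exists K : 'M[R]_(\rank (kermx B^T), n),
    row_free K /\ B *m K^T = 0.
  exists (row_base (kermx B^T)); split; first exact: row_base_free.
  apply: trmx_inj; rewrite trmx_mul trmxK trmx0.
  by apply/sub_kermxP; rewrite eq_row_base.
have KKu := gram_unitmx Kfree.
exists (K^T *m invmx (K *m K^T) *m K); split.
- by rewrite !trmx_mul trmxK trmx_inv trmx_mul trmxK mulmxA.
- by rewrite -!mulmxA (mulmxA K) mulKVmx.
- by rewrite !mulmxA BK !mul0mx.
- rewrite -mulmxA mxtrace_mulC -mulmxA mulVmx// mxtrace1.
  by rewrite mxrank_ker mxrank_tr.
Qed.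

(** Mass at most [1] per index and at least [n - r] in total costs the least
    when it sits on the last [n - r] indices.  Comparing every [tau i] with the
    threshold [c = tau r] makes this a termwise inequality. *)
Lemma sum_tail_le n r (tau q : 'I_n -> R) :
  (forall i, 0 <= tau i) -> (forall i j : 'I_n, (i <= j)%N -> tau j <= tau i) ->
  (forall i, 0 <= q i <= 1) -> (n - r)%:R <= \sum_i q i ->
  \sum_(i < n | (r <= i)%N) tau i <= \sum_i tau i * q i.
Proof.
move=> tau0 tau_dec q01 qsum.
(* when r = n the sum on the left is empty and c = 0 is a threshold *)
pose c := if insub r is Some i then tau i else 0 : R.
have c0 : 0 <= c by rewrite /c; case: insubP.
have below (i : 'I_n) : (i < r)%N -> c <= tau i.
  by rewrite /c; case: insubP => // j _ jr ir; rewrite tau_dec// jr ltnW.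
have above (i : 'I_n) : (r <= i)%N -> tau i <= c.
  rewrite /c; case: insubP => [j _ jr ri|]; first by rewrite tau_dec// jr.
  by rewrite -leqNgt => nr ri; have := leq_trans nr ri; rewrite leqNgt ltn_ord.
have cardr : \sum_(i < n | (r <= i)%N) (1 : R) = (n - r)%:R.
  rewrite -(big_mkord (fun i => r <= i)%N (fun=> 1 : R)).
  by rewrite -(big_nat_widenl r 0 n predT) ?sumr_const_nat.
rewrite -subr_ge0; apply: (@le_trans _ _ (c * (\sum_i q i - (n - r)%:R))).
  by rewrite mulr_ge0// subr_ge0.
rewrite -cardr [X in c * (_ - X)]big_mkcond [X in _ <= _ - X]big_mkcond/=.
rewrite -!sumrB mulr_sumr; apply: ler_sum => i _.
have /andP[qi0 qi1] := q01 i.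
case: ifPn => [ri|]; first by have := above i ri; nra.
by rewrite -ltnNge => ri; have := below i ri; nra.
Qed.

(** Let [Q] be the projector that kills [B].  Then
    [|D - B|^2 >= |(D - B) Q|^2 = |D Q|^2 = sum_i sigma_i^2 Q_ii], and the diagonal
    of [Q] lies in [[0, 1]] and has sum at least [n - r]. *)
Lemma eckart_young_diag n r (sigma : 'I_n -> R) (B : 'M[R]_n) :
  (forall i j : 'I_n, (i <= j)%N -> sigma j ^+ 2 <= sigma i ^+ 2) ->
  (\rank B <= r)%N ->
  \sum_(i < n | (r <= i)%N) sigma i ^+ 2 <=
  \sum_i \sum_j (sigma i *+ (i == j) - B i j) ^+ 2.
Proof.
move=> sig_dec Br; have [Q [Qsym Qidem BQ trQ]] := exists_kernel_projector B.
pose D : 'M[R]_n := diag_mx (\row_i sigma i).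
have QiiE i : Q i i = \sum_j Q i j ^+ 2.
  rewrite -{1}Qidem mxE; apply: eq_bigr => j _.
  by rewrite -[in Q j i]Qsym mxE expr2.
have Qii01 i : 0 <= Q i i <= 1.
  have Q0 : 0 <= Q i i by rewrite QiiE sumr_ge0// => j _; exact: sqr_ge0.
  rewrite Q0/=; have : Q i i ^+ 2 <= Q i i.
    rewrite [leRHS]QiiE (bigD1 i)//= lerDl sumr_ge0// => j _; exact: sqr_ge0.
  by move: Q0; nra.
apply: (@le_trans _ _ (\sum_i sigma i ^+ 2 * Q i i)).
  apply: sum_tail_le => //; first by move=> i; exact: sqr_ge0.
  by rewrite -/(mxtrace Q) trQ ler_nat leq_sub2l.
have -> : \sum_i \sum_j (sigma i *+ (i == j) - B i j) ^+ 2 =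
    \tr ((D - B) *m (D - B)^T).
  by rewrite mxtrace_gram; do 2!apply: eq_bigr => ? _; rewrite !mxE.
have -> : \sum_i sigma i ^+ 2 * Q i i = \tr ((D - B) *m Q *m (D - B)^T).
  have DBQ : (D - B) *m Q = D *m Q by rewrite mulmxBl BQ subr0.
  rewrite DBQ -Qidem mulmxA -[D *m Q *m Q *m _]mulmxA.
  have -> : Q *m (D - B)^T = (D *m Q)^T by rewrite -DBQ trmx_mul Qsym.
  rewrite trmx_mul Qsym mulmxA -(mulmxA D Q Q) Qidem.
  apply: eq_bigr => i _.
  by rewrite tr_diag_mx mul_mx_diag mul_diag_mx !mxE expr2 mulrAC.
rewrite -subr_ge0.
have -> : \tr ((D - B) *m (D - B)^T) - \tr ((D - B) *m Q *m (D - B)^T) =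
    \tr (((D - B) *m (1%:M - Q)) *m ((D - B) *m (1%:M - Q))^T).
  rewrite -raddfB/= -mulmxBl; congr (\tr _).
  rewrite trmx_mul mulmxA -(mulmxA (D - B)).
  have -> : (1%:M - Q) *m (1%:M - Q)^T = 1%:M - Q.
    rewrite linearB/= trmx1 Qsym mulmxBl mul1mx mulmxBr mulmx1 Qidem subrr subr0 //.
  by rewrite mulmxBr mulmx1.
exact: mxtrace_gram_ge0.
Qed.

End eckart_young.

(** * Simultaneous diagonalization of the pencil *)

Section spd_matrices.
Context {R : realType}.

Lemma col_mulmx n p q (A : 'M[R]_(n, p)) (B : 'M[R]_(p, q)) i :
  col i (A *m B) = A *m col i B.
Proof. by rewrite !colE mulmxA. Qed.

Lemma sqnorm_col n p (S : 'M[R]_n) (U : 'M[R]_(n, p)) i :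
  sqnorm S (col i U) = (U^T *m S *m U) i i.
Proof. by rewrite /sqnorm tr_col -!row_mul -col_mulmx !mxE. Qed.

Lemma spd_unitmx n (S : 'M[R]_n) : spd S -> S \in unitmx.
Proof.
move=> [_ Spos]; rewrite -row_free_unit; apply: inj_row_free => v vS.
apply/eqP; apply/negPn/negP => v0.
have /Spos : v^T != 0 by rewrite -trmx0 (inj_eq trmx_inj).
by rewrite /sqnorm trmxK vS mul0mx mxE ltxx.
Qed.

Lemma spd_ge0 n (S : 'M[R]_n) z : spd S -> 0 <= sqnorm S z.
Proof.
move=> [_ Spos]; have [->|/Spos/ltW//] := eqVneq z 0.
by rewrite /sqnorm mulmx0 mxE.
Qed.

End spd_matrices.

Section pencil.
Context {R : realType} m n (G : 'M[R]_(m, n)) (Gobs : 'M[R]_m)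
  (Gpr : 'M[R]_n) (lambda : 'I_n -> R) (w : 'I_n -> 'cV[R]_n).
Hypothesis hGobs : spd Gobs.
Hypothesis hGpr : spd Gpr.
Hypothesis hpencil : pencil_eigenpairs G Gobs Gpr lambda w.

Definition eigvec_mx : 'M[R]_n := \matrix_(i, j) w j i 0.
Local Notation W := eigvec_mx.
Local Notation K := (invmx Gpr).
Local Notation Delta := (diag_mx (\row_i lambda i)).

Lemma col_eigvec_mx i : col i W = w i.
Proof. by apply/matrixP => a b; rewrite ord1 !mxE. Qed.

Lemma tr_invmx_prior : K^T = K.
Proof. by rewrite trmx_inv (proj1 hGpr). Qed.

Lemma tr_invmx_obs : (invmx Gobs)^T = invmx Gobs.
Proof. by rewrite trmx_inv (proj1 hGobs). Qed.

Lemma eigvec_orthonormal : W^T *m K *m W = 1%:M.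
Proof.
case: hpencil => _ _ ortho; apply/matrixP => i j; rewrite [RHS]mxE -ortho.
rewrite -(col_eigvec_mx i) -(col_eigvec_mx j) tr_col -!row_mul -col_mulmx.
by rewrite !mxE.
Qed.

Lemma eigvec_mulVmx : W *m (W^T *m K) = 1%:M.
Proof. exact: mulmx1C eigvec_orthonormal. Qed.

Lemma eigvec_mul_tr : W *m W^T = Gpr.
Proof.
have := eigvec_mulVmx; rewrite mulmxA => /(congr1 (mulmx^~ Gpr)).
by rewrite mulmxKV ?mul1mx ?spd_unitmx.
Qed.

Lemma Hmx_eigvec : Hmx G Gobs *m W = K *m W *m Delta.
Proof.
case: hpencil => eigen _ _; apply/matrixP => i j.
have := congr1 (fun v : 'cV[R]_n => v i 0) (eigen j).
rewrite -(col_eigvec_mx j) -!col_mulmx.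
rewrite [LHS]mxE [RHS]mxE [X in _ * X]mxE => ->.
by rewrite mul_mx_diag [RHS]mxE [X in _ = _ * X]mxE mulrC.
Qed.

Lemma eigvec_Hmx_eigvec : W^T *m Hmx G Gobs *m W = Delta.
Proof. by rewrite -mulmxA Hmx_eigvec !mulmxA eigvec_orthonormal mul1mx. Qed.

Lemma sqnorm_invmx_obs_ge0 (v : 'cV[R]_m) : 0 <= sqnorm (invmx Gobs) v.
Proof.
have -> : sqnorm (invmx Gobs) v = sqnorm Gobs (invmx Gobs *m v).
  rewrite /sqnorm trmx_mul tr_invmx_obs !mulmxA.
  by rewrite mulmxKV ?spd_unitmx.
exact: spd_ge0.
Qed.

Lemma lambda_ge0 i : 0 <= lambda i.
Proof.
have : (W^T *m Hmx G Gobs *m W) i i = lambda i.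
  by rewrite eigvec_Hmx_eigvec !mxE eqxx mulr1n.
rewrite -sqnorm_col => <-.
have -> : sqnorm (Hmx G Gobs) (col i W) = sqnorm (invmx Gobs) (G *m col i W).
  by rewrite /sqnorm /Hmx trmx_mul !mulmxA.
exact: sqnorm_invmx_obs_ge0.
Qed.

Lemma lambda1_gt0 i : 0 < 1 + lambda i.
Proof. by rewrite ltr_pwDl ?lambda_ge0. Qed.

Lemma precision_eigvec :
  (Hmx G Gobs + K) *m W = K *m W *m diag_mx (\row_i (1 + lambda i)).
Proof.
rewrite mulmxDl Hmx_eigvec -[X in _ + X]mulmx1 -mulmxDr; congr (_ *m _).
by apply/matrixP => i j; rewrite !mxE -mulrnDl addrC.
Qed.

Lemma eigvec_precision_eigvec :
  W^T *m (Hmx G Gobs + K) *m W = diag_mx (\row_i (1 + lambda i)).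
Proof. by rewrite -mulmxA precision_eigvec !mulmxA eigvec_orthonormal mul1mx. Qed.

Lemma post_cov_eigvec :
  post_cov G Gobs Gpr = W *m diag_mx (\row_i (1 + lambda i)^-1) *m W^T.
Proof.
set X := RHS; have HX : (Hmx G Gobs + K) *m X = 1%:M.
  rewrite /X !mulmxA precision_eigvec -(mulmxA (K *m W)).
  have -> : diag_mx (\row_i (1 + lambda i)) *m diag_mx (\row_i (1 + lambda i)^-1)
      = 1%:M.
    apply/matrixP => i j; rewrite mul_diag_mx !mxE.
    have [->|_] := eqVneq i j; last by rewrite mulr0.
    by rewrite mulfV// gt_eqF ?lambda1_gt0.
  by rewrite mulmx1 -mulmxA eigvec_mul_tr mulVmx ?spd_unitmx.
have [Hu _] := mulmx1_unit HX.
by rewrite /post_cov -[LHS]mulmx1 -HX mulmxA mulVmx// mul1mx.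
Qed.

(** The loss is a sum of squares of linear functionals with nonnegative weights,
    so that its expectation can be computed term by term. *)
Lemma sqnorm_precision (z : 'cV[R]_n) :
  sqnorm (invmx (post_cov G Gobs Gpr)) z =
  \sum_i (1 + lambda i) * dotv (col i (K *m W)) z ^+ 2.
Proof.
rewrite /post_cov invmxK.
pose s := W^T *m K *m z.
have zE : z = W *m s by rewrite /s !mulmxA -(mulmxA W) eigvec_mulVmx mul1mx.
have dE i : dotv (col i (K *m W)) z = s i 0.
  by rewrite /dotv /s tr_col trmx_mul tr_invmx_prior -row_mul mxE.
rewrite {1}zE /sqnorm trmx_mul.
have -> : s^T *m W^T *m (Hmx G Gobs + K) *m (W *m s) =
    s^T *m (W^T *m (Hmx G Gobs + K) *m W) *m s by rewrite !mulmxA.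
rewrite eigvec_precision_eigvec mul_mx_diag mxE; apply: eq_bigr => i _.
by rewrite dE !mxE expr2; ring.
Qed.

(** The expected loss of [A y - e x], minus its part [e ^+ 2 * n] that does not
    depend on [A], for the estimator [A] that the matrix [C] represents in the
    eigenvector coordinates. *)
Definition weighted_error (C : 'M[R]_n) (e : R) : R :=
  \sum_i \sum_j (1 + lambda i) * (1 + lambda j) * lambda j *
    (C i j - (e / (1 + lambda i)) *+ (i == j)) ^+ 2.

(** In eigenvector coordinates the left-hand side is
    [sum_ij d_i ((lambda_j C_ij - e [i = j])^2 + lambda_j C_ij^2)]; the result is
    obtained by completing the square in each [C_ij]. *)
Lemma joint_var_estimator (C : 'M[R]_n) (e : R) :
  let A := W *m C *m W^T *m G^T *m invmx Gobs in
  \sum_i (1 + lambda i) * joint_var G Gobs Gpr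
    (- e *: col i (K *m W)) (A^T *m col i (K *m W)) =
  weighted_error C e + e ^+ 2 * n%:R.
Proof.
move=> A.
pose B := A^T *m (K *m W).
have BE : B = invmx Gobs *m G *m W *m C^T.
  rewrite /B /A !trmx_mul trmxK tr_invmx_obs !mulmxA trmxK.
  by rewrite -(mulmxA _ W^T K) -(mulmxA _ (W^T *m K) W) eigvec_orthonormal mulmx1.
(* column i of U is the weight of x in the conditional mean given x *)
pose U := K *m W *m (Delta *m C^T - e%:M).
have UE i : - e *: col i (K *m W) + G^T *m (A^T *m col i (K *m W)) = col i U.
  rewrite -!col_mulmx -/B BE !mulmxA -/(Hmx G Gobs) Hmx_eigvec.
  rewrite /U mulmxBr mul_mx_scalar mulmxA.
  by apply/matrixP => a b; rewrite !mxE; ring.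
have Uvar : U^T *m Gpr *m U = (Delta *m C^T - e%:M)^T *m (Delta *m C^T - e%:M).
  rewrite /U trmx_mul trmx_mul tr_invmx_prior -!mulmxA; congr (_ *m _).
  rewrite (mulmxA K Gpr) mulVmx ?spd_unitmx// mul1mx !mulmxA.
  by rewrite eigvec_orthonormal mul1mx.
have Bvar : B^T *m Gobs *m B = C *m Delta *m C^T.
  rewrite BE !trmx_mul trmxK tr_invmx_obs !mulmxA mulmxKV ?spd_unitmx//.
  rewrite -eigvec_Hmx_eigvec /Hmx !mulmxA //.
have -> : \sum_i (1 + lambda i) * joint_var G Gobs Gpr
    (- e *: col i (K *m W)) (A^T *m col i (K *m W)) =
  \sum_i (1 + lambda i) * (\sum_j ((lambda j * C i j - e *+ (i == j)) ^+ 2 +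
     lambda j * C i j ^+ 2)).
  apply: eq_bigr => i _; congr (_ * _).
  rewrite /joint_var UE -[A^T *m _]col_mulmx -/B !sqnorm_col Uvar Bvar.
  rewrite big_split/=; congr (_ + _).
    rewrite mxE; apply: eq_bigr => j _.
    by rewrite mul_diag_mx !mxE eq_sym expr2.
  rewrite mul_mx_diag mxE; apply: eq_bigr => j _; rewrite !mxE; ring.
have -> : e ^+ 2 * n%:R = \sum_(i < n) \sum_(j < n) (e ^+ 2 *+ (i == j) : R).
  rewrite -[X in X%:R](card_ord n) -sumr_const mulr_sumr.
  apply: eq_bigr => i _; rewrite (bigD1 i)//= eqxx big1 ?addr0 ?mulr1//.
  by move=> j; rewrite eq_sym => /negbTE ->.
rewrite /weighted_error -big_split/=; apply: eq_bigr => i _.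
rewrite mulr_sumr -big_split/=; apply: eq_bigr => j _.
have := lambda1_gt0 i; have [<-|_] := eqVneq i j => di.
  by rewrite !mulr1n; field; rewrite gt_eqF.
by rewrite !mulr0n; ring.
Qed.

End pencil.

(** * Bayes risk of an estimator *)

Lemma rank_sum_outer (F : fieldType) (n r : nat) (c : 'I_n -> F)
    (w : 'I_n -> 'cV[F]_n) : (r <= n)%N ->
  (\rank (\sum_(i < n | (i < r)%N) c i *: (w i *m (w i)^T))%R <= r)%N.
Proof.
move=> rn; have cardr : (\sum_(i < n | (i < r)%N) 1 = r)%N.
  rewrite -(big_mkord (fun i => i < r)%N (fun=> 1%N)).
  by rewrite -(big_nat_widen 0 r n predT)// sum_nat_const_nat subn0 muln1.
rewrite -[X in (_ <= X)%N]cardr.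
elim/big_rec2: _ => [|i k M _ IH]; first by rewrite mxrank0.
apply: leq_trans (mxrank_add _ _) _; apply: leq_add IH.
rewrite scalemxAl; apply: leq_trans (mxrankM_maxl _ _) _.
exact: rank_leq_col.
Qed.

Section risk_formula.
Context {R : realType} m n (G : 'M[R]_(m, n)) (Gobs : 'M[R]_m)
  (Gpr : 'M[R]_n) d (T : measurableType d) (P : probability T R)
  (x : {RV P >-> 'cV[R]_n}) (y : {RV P >-> 'cV[R]_m})
  (lambda : 'I_n -> R) (w : 'I_n -> 'cV[R]_n).
Hypothesis hGobs : spd Gobs.
Hypothesis hGpr : spd Gpr.
Hypothesis hmodel : bayes_linear_model G Gobs Gpr x y.
Hypothesis hpencil : pencil_eigenpairs G Gobs Gpr lambda w.
Local Notation W := (eigvec_mx w).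
Local Notation K := (invmx Gpr).

(** One formula for the three expectations of the theorem, see the choices of
    [C] and [e] in [weighted_error_approx], [weighted_error_post_cov] and
    [weighted_error_shift]. *)
Lemma expectation_estimator (C : 'M[R]_n) (e : R) :
  ('E_P[fun t => sqnorm (invmx (post_cov G Gobs Gpr))
     (W *m C *m W^T *m G^T *m invmx Gobs *m y t - e *: x t)] =
   (weighted_error lambda C e + e ^+ 2 * n%:R)%:E)%E.
Proof.
set A := W *m C *m W^T *m G^T *m invmx Gobs.
rewrite -(joint_var_estimator hGobs hGpr hpencil) -/A unlock.
pose a i := - e *: col i (K *m W); pose b i := A^T *m col i (K *m W).
have sE t : sqnorm (invmx (post_cov G Gobs Gpr)) (A *m y t - e *: x t) =
    \sum_i (1 + lambda i) * (dotv (a i) (x t) + dotv (b i) (y t)) ^+ 2.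
  rewrite (sqnorm_precision hGpr hpencil); apply: eq_bigr => i _.
  congr (_ * _ ^+ 2); rewrite /a dotvZl -dotv_mulmx /dotv mulmxBr.
  by rewrite [LHS]mxE [X in _ + X]mxE -scalemxAr [X in - X]mxE addrC mulNr.
under eq_integral do rewrite sE -sumEFin.
have m2 i : measurable_fun [set: T]
    (fun t => ((dotv (a i) (x t) + dotv (b i) (y t)) ^+ 2)%:E).
  apply/measurable_EFinP; apply: measurable_funX; exact: measurable_joint.
have l0 i : 0 <= 1 + lambda i by rewrite ltW// (lambda1_gt0 hGobs hpencil).
rewrite ge0_integral_sum//=.
- rewrite -sumEFin; apply: eq_bigr => i _.
  under eq_integral do rewrite EFinM.
  rewrite ge0_integralZl_EFin//.
    by rewrite (joint_second_moment hGobs hGpr hmodel).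
  by move=> t _; rewrite lee_fin sqr_ge0.
- by move=> i; under eq_fun do rewrite EFinM; exact: measurable_funeM.
- by move=> i t _; rewrite lee_fin mulr_ge0 ?sqr_ge0.
Qed.

Lemma eigvec_conjK (C : 'M[R]_n) : W *m (W^T *m K *m C *m K *m W) *m W^T = C.
Proof.
rewrite !mulmxA -(mulmxA W W^T K) (eigvec_mulVmx hpencil) mul1mx.
rewrite -[LHS]mulmxA (eigvec_mul_tr hGpr hpencil).
by rewrite mulmxKV ?spd_unitmx.
Qed.

Lemma approx_eigvec r :
  post_cov_approx Gpr lambda w r =
  W *m diag_mx (\row_i (1 - (lambda i / (1 + lambda i)) *+ (i < r)%N)) *m W^T.
Proof.
rewrite /post_cov_approx -(eigvec_mul_tr hGpr hpencil).
have -> : diag_mx (\row_i (1 - (lambda i / (1 + lambda i)) *+ (i < r)%N)) =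
    1%:M - diag_mx (\row_i ((lambda i / (1 + lambda i)) *+ (i < r)%N)).
  by apply/matrixP => i j; rewrite !mxE -mulrnBl.
rewrite mulmxBr mulmxBl mulmx1; congr (_ - _).
apply/matrixP => a b; rewrite summxE big_mkcond mxE; apply: eq_bigr => i _.
rewrite mul_mx_diag !mxE big_ord1 !mxE.
by case: (i < r)%N; rewrite ?mulr1n ?mulr0n ?mulr0 ?mul0r//; ring.
Qed.

(** Conjugating [B] by [D^(1/2)] on the left and by [(Delta D)^(1/2)] on the
    right turns the weighted error into the squared Frobenius distance of
    [Delta^(3/2)] to a matrix of rank at most [r]. *)
Lemma weighted_error_ge (r : nat) (B : 'M[R]_n) : (\rank B <= r)%N ->
  \sum_(i < n | (r <= i)%N) lambda i ^+ 3 <= weighted_error lambda (1%:M - B) 1.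
Proof.
move=> Br; have l0 := lambda_ge0 hGobs hpencil.
have d0 i := lambda1_gt0 hGobs hpencil i.
pose sigma i := Num.sqrt (lambda i) * lambda i.
have sigma2 i : sigma i ^+ 2 = lambda i ^+ 3.
  by rewrite exprMn sqr_sqrtr// [RHS]exprS.
pose p i := Num.sqrt (1 + lambda i).
pose q i := Num.sqrt (lambda i) * p i.
pose B' := diag_mx (\row_i p i) *m B *m diag_mx (\row_i q i).
have rB' : (\rank B' <= r)%N.
  by apply: leq_trans Br; rewrite (leq_trans (mxrankM_maxl _ _))// mxrankM_maxr.
have sig_dec (i j : 'I_n) : (i <= j)%N -> sigma j ^+ 2 <= sigma i ^+ 2.
  case: hpencil => _ l_dec _ ij; rewrite !sigma2.
  by rewrite ler_pXn2r ?nnegrE// l_dec.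
under eq_bigr do rewrite -sigma2.
apply: le_trans (eckart_young_diag sig_dec rB') _.
rewrite /weighted_error le_eqVlt; apply/orP; left; apply/eqP.
apply: eq_bigr => i _; apply: eq_bigr => j _.
have p2 k : p k ^+ 2 = 1 + lambda k by rewrite sqr_sqrtr// ltW.
have q2 k : q k ^+ 2 = lambda k * (1 + lambda k) by rewrite exprMn p2 sqr_sqrtr.
have -> : sigma i *+ (i == j) - B' i j =
    p i * q j * ((1%:M - B) i j - 1 / (1 + lambda i) *+ (i == j)).
  rewrite /B' mul_mx_diag mul_diag_mx !mxE.
  have [<-|_] := eqVneq i j; last by rewrite !mulr0n; ring.
  have pi0 : p i != 0 by rewrite gt_eqF// sqrtr_gt0.
  have -> : sigma i = Num.sqrt (lambda i) * (p i ^+ 2 - 1).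
    by rewrite p2 addrC addKr.
  by rewrite !mulr1n /q -p2; field.
by rewrite exprMn [(p i * q j) ^+ 2]exprMn p2 q2; ring.
Qed.

Lemma weighted_error_approx (r : nat) :
  weighted_error lambda
    (diag_mx (\row_i (1 - (lambda i / (1 + lambda i)) *+ (i < r)%N))) 1 =
  \sum_(i < n | (r <= i)%N) lambda i ^+ 3.
Proof.
rewrite /weighted_error [RHS]big_mkcond; apply: eq_bigr => i _.
rewrite (bigD1 i)//= big1 ?addr0; last first.
  move=> j; rewrite eq_sym => /negbTE ij.
  by rewrite !mxE ij !mulr0n subr0 expr0n mulr0.
have d0 := lambda1_gt0 hGobs hpencil i.
rewrite !mxE eqxx !mulr1n; case: ltnP => _.
  by rewrite mulr1n; field; rewrite gt_eqF.
by rewrite mulr0n; field; rewrite gt_eqF.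
Qed.

Lemma weighted_error_post_cov :
  weighted_error lambda (diag_mx (\row_i (1 + lambda i)^-1)) 1 = 0.
Proof.
rewrite /weighted_error big1// => i _; rewrite big1// => j _.
by rewrite !mxE mul1r; case: eqP => [->|_]; rewrite subrr expr0n mulr0.
Qed.

(** The risk of an estimator, up to the constant [n], is its mean squared
    distance to the posterior mean. *)
Lemma weighted_error_shift (C : 'M[R]_n) :
  weighted_error lambda (C - diag_mx (\row_i (1 + lambda i)^-1)) 0 =
  weighted_error lambda C 1.
Proof.
rewrite /weighted_error; apply: eq_bigr => i _; apply: eq_bigr => j _.
by rewrite !mxE mul0r mul0rn subr0 mul1r.
Qed.

End risk_formula.

Theorem theorem4p2 (R : realType) (m n r : nat)
    (G : 'M[R]_(m, n)) (Gobs : 'M[R]_m) (Gpr : 'M[R]_n)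
    (hGobs : spd Gobs) (hGpr : spd Gpr)
    (d : measure_display) (T : measurableType d) (P : probability T R)
    (x : {RV P >-> 'cV[R]_n}) (y : {RV P >-> 'cV[R]_m})
    (hmodel : bayes_linear_model G Gobs Gpr x y)
    (* indices start at 0: delta2 i is delta_{i+1}^2 *)
    (delta2 : 'I_n -> R) (w : 'I_n -> 'cV[R]_n)
    (hpencil : pencil_eigenpairs G Gobs Gpr delta2 w)
    (hr : (1 <= r <= n)%N) :
  let Astar := post_cov_approx Gpr delta2 w r *m G^T *m invmx Gobs in
  let Gpos := post_cov G Gobs Gpr in
  let mupos := post_mean G Gobs Gpr in
  let risk := bayes_risk G Gobs Gpr P x y in
  (estimators G Gobs Gpr r Astar /\
   forall A, estimators G Gobs Gpr r A -> (risk Astar <= risk A)%E) /\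
  (risk Astar =
     'E_P[fun t => sqnorm (invmx Gpos) (Astar *m y t - mupos (y t))] +
     'E_P[fun t => sqnorm (invmx Gpos) (mupos (y t) - x t)] /\
   risk Astar = (\sum_(i < n | (r <= i)%N) delta2 i ^+ 3 + n%:R)%:E)%E.
Proof.
move=> Astar Gpos mupos risk.
pose W := eigvec_mx w; pose F C := W *m C *m W^T *m G^T *m invmx Gobs.
have riskF C : risk (F C) = (weighted_error delta2 C 1 + n%:R)%:E.
  rewrite /risk /bayes_risk.
  have := expectation_estimator hGobs hGpr hmodel hpencil C 1.
  rewrite expr1n mul1r => <-; congr expectation.
  by apply/funext => t; rewrite scale1r.
pose Cstar : 'M[R]_n :=
  diag_mx (\row_i (1 - (delta2 i / (1 + delta2 i)) *+ (i < r)%N)).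
pose Cpos : 'M[R]_n := diag_mx (\row_i (1 + delta2 i)^-1).
have AstarE : Astar = F Cstar.
  by rewrite /Astar (approx_eigvec hGpr hpencil).
have muposE b : mupos b = F Cpos *m b.
  by rewrite /mupos /post_mean (post_cov_eigvec hGobs hGpr hpencil).
have riskAstar : risk Astar =
    (\sum_(i < n | (r <= i)%N) delta2 i ^+ 3 + n%:R)%:E.
  by rewrite AstarE riskF (weighted_error_approx hGobs hpencil).
split; split=> //.
- exists (\sum_(i < n | (i < r)%N)
      (delta2 i * (1 + delta2 i)^-1) *: (w i *m (w i)^T)) => //.
  by apply: rank_sum_outer; case/andP: hr.
- move=> A [B Br ->]; rewrite riskAstar.
  set K := invmx Gpr.
  pose B' := W^T *m K *m B *m K *m W.
  have -> : (Gpr - B) *m G^T *m invmx Gobs = F (1%:M - B').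
    congr (_ *m _ *m _); rewrite mulmxBr mulmxBl mulmx1.
    by rewrite (eigvec_mul_tr hGpr hpencil) (eigvec_conjK hGpr hpencil).
  rewrite riskF lee_fin lerD2r; apply: (weighted_error_ge hGobs hpencil).
  apply: leq_trans Br; rewrite /B'.
  do 2 (apply: leq_trans (mxrankM_maxl _ _) _).
  exact: mxrankM_maxr.
- rewrite {1}AstarE riskF.
  have -> : 'E_P[fun t => sqnorm (invmx Gpos) (Astar *m y t - mupos (y t))]%E =
      (weighted_error delta2 Cstar 1)%:E.
    have := expectation_estimator hGobs hGpr hmodel hpencil (Cstar - Cpos) 0.
    rewrite weighted_error_shift expr0n mul0r addr0 => <-; congr expectation.
    apply/funext => t; congr (sqnorm _ _).
    by rewrite scale0r subr0 AstarE muposE /F mulmxBr !mulmxBl.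
  have -> : 'E_P[fun t => sqnorm (invmx Gpos) (mupos (y t) - x t)]%E = n%:R%:E.
    have := expectation_estimator hGobs hGpr hmodel hpencil Cpos 1.
    rewrite weighted_error_post_cov expr1n mul1r add0r => <-; congr expectation.
    by apply/funext => t; rewrite scale1r muposE.
  by rewrite EFinD.
Qed.
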